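(* Let $(m_1,n_1)$ and $(m_2,n_2)$ be allowable pairs such that the sets $\{|t_1(m_1,n_1)|,|t_2(m_1,n_1)|,|t_3(m_1,n_1)|\}$ and $\{|t_1(m_2,n_2)|,|t_2(m_2,n_2)|,|t_3(m_2,n_2)|\}$ coincide. Then $c_1=-\frac{A(m_1,n_1)}{B(m_1,n_1)}$ equals $c_2=-\frac{A(m_2,n_2)}{B(m_2,n_2)}$. In other words, the absolute values of the numerators of the elements of the rational $3$-cycle of $f_c(x)=x^2+c$ determine $c$.
   Context: An allowable pair is $(m,n)\in\mathbb{Z}^2$ with $\gcd(m,n)=1$ and $mn(m+n)\neq0$. $t_1(m,n)=m^3+2m^2n+mn^2+n^3$, $t_2(m,n)=m^3-mn^2-n^3$, $t_3(m,n)=m^3+2m^2n+3mn^2+n^3$; $A(m,n)=m^6+2m^5n+4m^4n^2+8m^3n^3+9m^2n^4+4mn^5+n^6$, $B(m,n)=4m^2n^2(m+n)^2$. For an allowable pair, $f_c$ with $c=-A/B$ has the rational $3$-cycle $\{\frac{t_1}{2mn(m+n)},\frac{t_2}{2mn(m+n)},-\frac{t_3}{2mn(m+n)}\}$, fractions in lowest terms. *)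

(* Defs.v *)
From mathcomp Require Import all_boot all_order all_algebra.
Set Implicit Arguments. Unset Strict Implicit. Unset Printing Implicit Defensive.
Import Order.TTheory GRing.Theory Num.Theory.
Local Open Scope ring_scope.

Definition allowable (m n : int) : Prop :=
  gcdz m n = 1 /\ m * n * (m + n) != 0.

Definition t1 (m n : int) : int := m^+3 + 2 * m^+2 * n + m * n^+2 + n^+3.
Definition t2 (m n : int) : int := m^+3 - m * n^+2 - n^+3.
Definition t3 (m n : int) : int := m^+3 + 2 * m^+2 * n + 3 * m * n^+2 + n^+3.

Definition Apoly (m n : int) : int :=
  m^+6 + 2 * m^+5 * n + 4 * m^+4 * n^+2 + 8 * m^+3 * n^+3 + 9 * m^+2 * n^+4 + 4 * m * n^+5 + n^+6.
Definition Bpoly (m n : int) : int := 4 * m^+2 * n^+2 * (m + n)^+2.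

Definition cpar (m n : int) : rat := - ((Apoly m n)%:~R / (Bpoly m n)%:~R).

Definition absnums (m n : int) : seq int := [:: `|t1 m n|; `|t2 m n|; `|t3 m n|].

(* Main.v *)
(** Put k = - (m + n), q = m^2 + m n + n^2 and T = (t1, t2, - t3), the
    numerators of the cycle.  Then T1 - T2 = 2 n q, T2 - T3 = 2 m q,
    T3 - T1 = 2 k q and T1 + T2 = - 2 m^2 k, T1 + T3 = - 2 n^2 m,
    T2 + T3 = - 2 k^2 n, and the substitution m -> n -> k -> m rotates T.

    Let T and T' agree up to order and signs.  If the signs can be taken
    uniform, comparing differences gives q = q' and then (m, n) = (m', n') up
    to this rotation and a sign, odd permutations of T being excluded by the
    sums.  If the signs are mixed, one difference of T is up to sign a
    difference of T' and another one is a sum of T'; as q' is coprime to m', n'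
    and k', this forces q to divide one of m', n', k', so 3 q^2 <= 4 q'.  By
    symmetry 3 q'^2 <= 4 q, which is impossible since q, q' > 1. *)

Require Import Defs.
From mathcomp Require Import all_boot all_order all_algebra.
From mathcomp Require Import ring lra zify.
Import Order.TTheory GRing.Theory Num.Theory.
Local Open Scope ring_scope.

Definition qnorm (m n : int) : int := m ^+ 2 + m * n + n ^+ 2.

Lemma allowable_neq0 (m n : int) :
  allowable m n -> [/\ m != 0, n != 0 & m + n != 0].
Proof. by case=> _; rewrite !mulf_eq0 !negb_or -andbA => /and3P. Qed.

Lemma allowableN (m n : int) : allowable m n -> allowable (- m) (- n).
Proof.
case=> g h; split; first by rewrite gcdzN gcdNz.
by rewrite -opprD mulrNN mulrN oppr_eq0.
Qed.

Lemma allowable_rot (m n : int) : allowable m n -> allowable n (- (m + n)).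
Proof.
case=> g h; split.
  by rewrite gcdzN -{2}[n]mul1r addrC gcdzMDl gcdzC.
by have -> : n * - (m + n) * (n + - (m + n)) = m * n * (m + n) by ring.
Qed.

Lemma cparN (m n : int) : cpar (- m) (- n) = cpar m n.
Proof.
by congr (- (_%:~R / _%:~R)); rewrite /Apoly /Bpoly; ring.
Qed.

Lemma cpar_rot (m n : int) : cpar n (- (m + n)) = cpar m n.
Proof.
by congr (- (_%:~R / _%:~R)); rewrite /Apoly /Bpoly; ring.
Qed.

Lemma absnumsN (m n : int) : absnums (- m) (- n) = absnums m n.
Proof.
have h1 : t1 (- m) (- n) = - t1 m n by rewrite /t1; ring.
have h2 : t2 (- m) (- n) = - t2 m n by rewrite /t2; ring.
have h3 : t3 (- m) (- n) = - t3 m n by rewrite /t3; ring.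
by rewrite /absnums h1 h2 h3 !normrN.
Qed.

Lemma absnums_rot (m n : int) :
  absnums n (- (m + n)) = [:: `|t3 m n|; `|t1 m n|; `|t2 m n|].
Proof.
have h1 : t1 n (- (m + n)) = - t3 m n by rewrite /t1 /t3; ring.
have h2 : t2 n (- (m + n)) = t1 m n by rewrite /t1 /t2; ring.
have h3 : t3 n (- (m + n)) = - t2 m n by rewrite /t2 /t3; ring.
by rewrite /absnums h1 h2 h3 !normrN.
Qed.

Lemma qnorm_gt1 (m n : int) : allowable m n -> 1 < qnorm m n.
Proof. by move=> /allowable_neq0 []; rewrite /qnorm; nia. Qed.

(** Sums and differences of the [t]'s factor into the nonzero [m], [n], [m + n] and [qnorm m n].
    Distinctness lets equality of sets be read as a permutation. *)
Lemma absnums_uniq (m n : int) : allowable m n -> uniq (absnums m n).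
Proof.
move=> amn; have [m0 n0 k0] := allowable_neq0 _ _ amn.
have q0 : qnorm m n != 0 by rewrite gt_eqF // (lt_trans _ (qnorm_gt1 _ _ amn)).
rewrite /= !inE !andbT negb_or !eqr_norm2 !negb_or.
rewrite -!(subr_eq0 (t1 m n)) -!(subr_eq0 (t2 m n)) !opprK.
have -> : t1 m n - t2 m n = 2 * n * qnorm m n by rewrite /t1 /t2 /qnorm; ring.
have -> : t1 m n + t2 m n = 2 * m ^+ 2 * (m + n) by rewrite /t1 /t2; ring.
have -> : t1 m n - t3 m n = - (2 * n ^+ 2 * m) by rewrite /t1 /t3; ring.
have -> : t1 m n + t3 m n = 2 * (m + n) * qnorm m n.
  by rewrite /t1 /t3 /qnorm; ring.
have -> : t2 m n - t3 m n = - (2 * (m + n) ^+ 2 * n) by rewrite /t2 /t3; ring.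
have -> : t2 m n + t3 m n = 2 * m * qnorm m n by rewrite /t2 /t3 /qnorm; ring.
by rewrite !oppr_eq0 !mulf_neq0 ?expf_neq0.
Qed.

(** Modulo [x] the form is [y ^+ 2], and modulo [y] it is [x ^+ 2]. *)
Lemma coprime_qnorm (x y : int) : gcdz x y = 1 ->
  coprimez (qnorm x y) x /\ coprimez (qnorm x y) y.
Proof.
move=> g; have cxy : coprimez x y by rewrite /coprimez g.
split; rewrite coprimez_sym /coprimez /qnorm.
  have -> : x ^+ 2 + x * y + y ^+ 2 = (x + y) * x + y ^+ 2 by ring.
  by rewrite gcdzMDl; apply: coprimezXr.
have -> : x ^+ 2 + x * y + y ^+ 2 = (x + y) * y + x ^+ 2 by ring.
by rewrite gcdzMDl; apply: coprimezXr; rewrite coprimez_sym.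
Qed.

(** Since [qnorm m n] is coprime to [n * m], the gcd of [n * qnorm m n] and [n * (n * m)] is [n] up
    to sign, so [q] divides [n]. The bound follows from [4 * qnorm m n = (2 * m + n) ^+ 2 + 3 * n ^+
    2]. *)
Lemma mixed_bound (q m n a b : int) : allowable m n -> 0 < q ->
  n * qnorm m n = a * q -> n ^+ 2 * m = b * q ->
  3 * q ^+ 2 <= 4 * qnorm m n.
Proof.
move=> amn q0 e1 e2; have [_ n0 _] := allowable_neq0 _ _ amn.
have [cm cn] := coprime_qnorm _ _ amn.1.
have d1 : (q %| n * qnorm m n)%Z by rewrite e1 dvdz_mull.
have d2 : (q %| n * (n * m))%Z by rewrite mulrA -expr2 e2 dvdz_mull.
have qn : (q %| n)%Z.
  have : (q %| gcdz (n * qnorm m n) (n * (n * m)))%Z by rewrite dvdz_gcd d1.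
  rewrite -mulz_gcdr.
  have /eqP -> : coprimez (qnorm m n) (n * m) by rewrite coprimezMr cn cm.
  by rewrite mulr1 !dvdzE absz_id.
have [z nE] := dvdzP qn.
have z0 : z != 0 by apply: contraNneq n0 => z0; rewrite nE z0 mul0r.
have zz : 1 <= z ^+ 2 by nia.
have : q ^+ 2 <= n ^+ 2 by rewrite nE exprMn ler_peMl // sqr_ge0.
have : 0 <= (2 * m + n) ^+ 2 by apply: sqr_ge0.
by rewrite /qnorm; lra.
Qed.

Lemma mixed_absurd (m1 n1 m2 n2 a b c d : int) :
  allowable m1 n1 -> allowable m2 n2 ->
  n2 * qnorm m2 n2 = a * qnorm m1 n1 -> n2 ^+ 2 * m2 = b * qnorm m1 n1 ->
  n1 * qnorm m1 n1 = c * qnorm m2 n2 -> n1 ^+ 2 * m1 = d * qnorm m2 n2 ->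
  False.
Proof.
move=> a1 a2 ea eb ec ed.
have q1 := qnorm_gt1 _ _ a1; have q2 := qnorm_gt1 _ _ a2.
have b2 := mixed_bound _ _ _ _ _ a2 (lt_trans ltr01 q1) ea eb.
have b1 := mixed_bound _ _ _ _ _ a1 (lt_trans ltr01 q2) ec ed.
(* Adding the bounds gives 3 (q1^2 + q2^2) <= 4 (q1 + q2), while q^2 >= 2 q for q >= 2. *)
by move: q1 q2 b1 b2; move: (qnorm m1 n1) (qnorm m2 n2); nia.
Qed.

(** Each positive factor is recovered as the gcd of the two products, so the factors agree and
    cancel. *)
Lemma qnorm_cancel (m1 n1 m2 n2 q1 q2 : int) :
  gcdz m1 n1 = 1 -> gcdz m2 n2 = 1 -> 0 < q1 -> 0 < q2 ->
  m1 * q1 = m2 * q2 -> n1 * q1 = n2 * q2 -> m1 = m2 /\ n1 = n2.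
Proof.
move=> g1 g2 q1_gt0 q2_gt0 em en.
have q12 : q1 = q2.
  have : gcdz (m1 * q1) (n1 * q1) = gcdz (m2 * q2) (n2 * q2).
    by rewrite em en.
  by rewrite -!mulz_gcdl g1 g2 !mul1r !gtz0_abs.
have q20 : q2 != 0 by rewrite gt_eqF.
by rewrite q12 in em en; split; apply: (mulIf q20).
Qed.

Lemma cpar_eq_t1 (m1 n1 m2 n2 : int) :
  allowable m1 n1 -> allowable m2 n2 -> t1 m1 n1 = t1 m2 n2 ->
  (`|t2 m1 n1| = `|t2 m2 n2| /\ `|t3 m1 n1| = `|t3 m2 n2|) \/
  (`|t2 m1 n1| = `|t3 m2 n2| /\ `|t3 m1 n1| = `|t2 m2 n2|) ->
  cpar m1 n1 = cpar m2 n2.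
Proof.
move=> a1 a2 e1.
have r1 := allowable_rot _ _ a1; have r2 := allowable_rot _ _ a2.
have rr1 := allowable_rot _ _ r1; have rr2 := allowable_rot _ _ r2.
have q1 := lt_trans ltr01 (qnorm_gt1 _ _ a1).
have q2 := lt_trans ltr01 (qnorm_gt1 _ _ a2).
have [m20 n20 k20] := allowable_neq0 _ _ a2.
(* Two matchings with two signs each give eight cases. Only the first and the last have uniform
   signs for T = (t1, t2, - t3). In the six others, rotating the pairs brings the shared difference
   to T1 - T2 and the sum to T1 + T3; the witnesses are, up to sign, entries m, n, m + n of the
   opposite pair. *)
case=> [] [] /eqP; rewrite eqr_norm2 => /orP [] /eqP e2;
  move=> /eqP; rewrite eqr_norm2 => /orP [] /eqP e3;
  move: e1 e2 e3; rewrite /t1 /t2 /t3 => e1 e2 e3.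
- have [-> ->] // : m1 = m2 /\ n1 = n2.
  by apply: (qnorm_cancel _ _ _ _ _ _ a1.1 a2.1 q1 q2); rewrite /qnorm; lra.
- case: (mixed_absurd _ _ _ _ n1 (- (m1 + n1)) n2 (- (m2 + n2)) a1 a2);
    rewrite /qnorm; lra.
- case: (mixed_absurd _ _ _ _ (- (m1 + n1)) m1 (- (m2 + n2)) m2 r1 r2);
    rewrite /qnorm; lra.
- case: (mixed_absurd _ _ _ _ (- m1) (- n1) (- m2) (- n2) rr1 rr2);
    rewrite /qnorm; lra.
- case: (mixed_absurd _ _ _ _ m1 (- (m1 + n1)) m2 (- (m2 + n2)) rr1 rr2);
    rewrite /qnorm; lra.
- case: (mixed_absurd _ _ _ _ (m1 + n1) (- n1) (- n2) (- m2) r1 a2);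
    rewrite /qnorm; lra.
- case: (mixed_absurd _ _ _ _ (- n1) (- m1) (m2 + n2) (- n2) a1 r2);
    rewrite /qnorm; lra.
(* Here T is T' with its last two entries exchanged, the odd permutation to be excluded. *)
- have g : gcdz (- m2) (m2 + n2) = 1.
    by rewrite gcdNz -{2}[m2]mul1r gcdzMDl a2.1.
  have [mE nE] : m1 = - m2 /\ n1 = m2 + n2.
    by apply: (qnorm_cancel _ _ _ _ _ _ a1.1 g q1 q2); rewrite /qnorm; lra.
  (* This product is [t1 (- m2) (m2 + n2) - t1 m2 n2]. *)
  have /eqP : m2 * n2 * (m2 + n2) = 0 by rewrite mE nE in e1; lra.
  by rewrite !mulf_eq0 (negPf m20) (negPf n20) (negPf k20).
Qed.

Lemma cpar_eq_norm_t1 (m1 n1 m2 n2 : int) :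
  allowable m1 n1 -> allowable m2 n2 -> absnums m1 n1 =i absnums m2 n2 ->
  `|t1 m1 n1| = `|t1 m2 n2| -> cpar m1 n1 = cpar m2 n2.
Proof.
(* Negating the second pair negates its [t1] and preserves [cpar] and [absnums]. *)
move=> a1 a2; wlog e1 : m2 n2 a2 / t1 m1 n1 = t1 m2 n2.
  move=> IH e /eqP; rewrite eqr_norm2 => /orP [] /eqP e1.
    by apply: IH; rewrite ?e1.
  have e1' : t1 m1 n1 = t1 (- m2) (- n2) by rewrite e1 /t1; ring.
  rewrite -(cparN m2); apply: IH; rewrite ?absnumsN ?e1' //.
  exact: allowableN.
move=> e _; apply: cpar_eq_t1 => //.
have u1 := absnums_uniq _ _ a1; have u2 := absnums_uniq _ _ a2.
have : perm_eq (absnums m1 n1) (absnums m2 n2) by apply: uniq_perm.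
rewrite /absnums e1 perm_cons => p.
have := perm_mem p `|t2 m1 n1|; rewrite !inE eqxx /=.
move=> /esym /orP [] /eqP E; [left | right]; split=> //.
  move: p; rewrite E perm_cons => p.
  exact: (congr1 (head 0) (perm_small_eq _ p)).
move: p; rewrite E perm_sym -(perm_rot 1) perm_cons => p.
exact: esym (congr1 (head 0) (perm_small_eq _ p)).
Qed.

Theorem theorem9 (m1 n1 m2 n2 : int) :
  allowable m1 n1 -> allowable m2 n2 ->
  absnums m1 n1 =i absnums m2 n2 ->
  cpar m1 n1 = cpar m2 n2.
Proof.
move=> a1 a2 e.
have r2 := allowable_rot _ _ a2; have rr2 := allowable_rot _ _ r2.
have rot m n : absnums m n =i absnums n (- (m + n)).
  by move=> x; rewrite absnums_rot -(mem_rot 2).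
have er x : x \in absnums m1 n1 = (x \in absnums n2 (- (m2 + n2))).
  by rewrite e rot.
have err x : x \in absnums m1 n1 =
    (x \in absnums (- (m2 + n2)) (- (n2 + - (m2 + n2)))).
  by rewrite er rot.
have h1 m n : `|t1 n (- (m + n))| = `|t3 m n|.
  exact: (congr1 (head 0) (absnums_rot m n)).
have h3 m n : `|t3 n (- (m + n))| = `|t2 m n|.
  exact: (congr1 (nth 0 ^~ 2%N) (absnums_rot m n)).
(* Rotating the second pair once or twice moves its [t3] or [t2] into the place of [t1]. *)
have := e `|t1 m1 n1|; rewrite !inE eqxx /= => /esym /or3P [] /eqP t.
- exact: cpar_eq_norm_t1.
- rewrite -(cpar_rot m2) -(cpar_rot n2).
  by apply: cpar_eq_norm_t1 => //; rewrite t h1 h3.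
- by rewrite -(cpar_rot m2); apply: cpar_eq_norm_t1 => //; rewrite t h1.
Qed.
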